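(* Let $m>0$, $\alpha\in\mathbb{R}$, and let $L(t,q,\dot q):=\frac12m\lVert\dot q\rVert^2-U(q)$, where the smooth potential $U$ is positively homogeneous of degree $\alpha$, i.e. $U(\lambda q)=\lambda^\alpha U(q)$ for all $\lambda>0$. Let $t\mapsto q(t)$, $t\in I$, be a solution to the Lagrange equation of $L$, let $E:=\frac12m\lVert\dot q\rVert^2+U(q)$ be the energy, and let $t_0\in I$. Then the following function is constant on $I$: $$t\mapsto m\,q(t)\cdot\dot q(t)+\Bigl(\frac{\alpha}{2}-1\Bigr)tE-\Bigl(\frac{\alpha}{2}+1\Bigr)\int_{t_0}^tL\bigl(s,q(s),\dot q(s)\bigr)\,ds .$$
   Context: $U$ is a smooth real function on an open set $D\subseteq\mathbb{R}^n$ that is closed under multiplication by positive scalars; $x\cdot y$ and $\lVert x\rVert$ are the Euclidean inner product and norm on $\mathbb{R}^n$; a dot over a function denotes the derivative in $t$. The trajectory $q$ is smooth on an open interval $I$ with values in $D$. The Lagrange equation is $\frac{d}{dt}\partial_{\dot q}L(t,q(t),\dot q(t))-\partial_qL(t,q(t),\dot q(t))=0$ for all $t\in I$, i.e. $m\ddot q(t)=-\nabla U(q(t))$. In the formula, $E$ is evaluated along $q(t)$. *)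

(* Defs.v *)
From HB Require Import structures.
From mathcomp Require Import all_boot all_order all_algebra.
From mathcomp Require Import all_classical all_reals all_analysis.

Set Implicit Arguments.
Unset Strict Implicit.
Unset Printing Implicit Defensive.

Import Order.TTheory GRing.Theory Num.Theory.
Import numFieldNormedType.Exports.

Local Open Scope classical_set_scope.
Local Open Scope ring_scope.

(* The norm that the library puts on 'rV[R]_n is the max norm (it induces the
   usual topology and differential calculus); the Euclidean norm is enorm. *)
Definition dotv {R : realType} {n : nat} (x y : 'rV[R]_n) : R :=
  \sum_(i < n) x 0 i * y 0 i.

Definition enorm {R : realType} {n : nat} (x : 'rV[R]_n) : R :=
  Num.sqrt (dotv x x).

Definition grad {R : realType} {n : nat} (f : 'rV[R]_n -> R) (x : 'rV[R]_n) :
    'rV[R]_n :=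
  \row_(i < n) 'D_(delta_mx 0 i) f x.

(* Intended for finite-dimensional V and W and an open set A, where it is the
   usual C^k: continuity for k = 0; for k + 1, differentiability with all
   directional derivatives (hence all partial derivatives) of class C^k. *)
Fixpoint Ck_on {R : realType} {V W : normedModType R} (k : nat) (A : set V)
    (f : V -> W) : Prop :=
  if k is k'.+1 then
    (forall x, A x -> differentiable f x) /\
    (forall v : V, Ck_on k' A (fun x => 'D_v f x))
  else forall x, A x -> {for x, continuous f}.

Definition smooth_on {R : realType} {V W : normedModType R} (A : set V)
    (f : V -> W) : Prop :=
  forall k : nat, Ck_on k A f.

(* Library integrals are over sets, so the sign for b < a is put in by hand. *)
Definition oriented_integral {R : realType} (a b : R) (f : R -> R) : R :=
  if a <= b then \int[lebesgue_measure]_(s in `[a, b]) f s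
  else - \int[lebesgue_measure]_(s in `[b, a]) f s.

Definition lagrangian {R : realType} {n : nat} (m : R) (U : 'rV[R]_n -> R)
    (t : R) (x v : 'rV[R]_n) : R :=
  2^-1 * m * enorm v ^+ 2 - U x.

Definition energy {R : realType} {n : nat} (m : R) (U : 'rV[R]_n -> R)
    (x v : 'rV[R]_n) : R :=
  2^-1 * m * enorm v ^+ 2 + U x.

Definition lagrange_equation {R : realType} {n : nat}
    (L : R -> 'rV[R]_n -> 'rV[R]_n -> R) (I : set R) (q : R -> 'rV[R]_n) :
    Prop :=
  forall t, I t ->
    derive1 (fun s => grad (fun v => L s (q s) v) (derive1 q s)) t
    - grad (fun x => L t x (derive1 q t)) (q t) = 0.

(* Main.v *)
Require Import Defs.
From HB Require Import structures.
From mathcomp Require Import all_boot all_order all_algebra.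
From mathcomp Require Import all_classical all_reals all_analysis.
From mathcomp Require Import lra.

Import Order.TTheory GRing.Theory Num.Theory.
Import numFieldNormedType.Exports.

Local Open Scope classical_set_scope.
Local Open Scope ring_scope.

(** Put [H t := m q.q' + (alpha/2 - 1) t E].  Everything rests on the identity
    [H' = (alpha/2 + 1) L] on [I].  The Lagrange equation of this Lagrangian is
    Newton's equation [m q'' = - grad U (q)] ([newton_equation]).  Paired with
    [q'] and combined with the chain rule, it gives [E' = 0].  Paired with [q],
    it gives [m q.q'' = - q.grad U (q) = - alpha U(q)], by Euler's identity for
    homogeneous functions ([euler_homogeneous]).  Hence
      [H' = m |q'|^2 - alpha U + (alpha/2 - 1) (m |q'|^2 / 2 + U)
          = (alpha/2 + 1) (m |q'|^2 / 2 - U)].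
    By the fundamental theorem of calculus ([oriented_integral_scaled_FTC]),
    the function of the theorem is then [H t - (H t - H t0) = H t0]. *)

Lemma dotvZr {R : realType} {n : nat} (k : R) (x y : 'rV[R]_n) :
  dotv x (k *: y) = k * dotv x y.
Proof. by rewrite mulr_sumr; apply: eq_bigr => i _; rewrite mxE mulrCA. Qed.

Lemma dotv_delta {R : realType} {n : nat} (x : 'rV[R]_n) (i : 'I_n) :
  dotv x (delta_mx 0 i) = x 0 i.
Proof.
rewrite /dotv (bigD1 i)//= big1 => [|j /negPf ji].
  by rewrite mxE !eqxx mulr1 addr0.
by rewrite mxE ji andbF mulr0.
Qed.

Lemma enorm_sqr {R : realType} {n : nat} (x : 'rV[R]_n) :
  enorm x ^+ 2 = dotv x x.
Proof. by rewrite sqr_sqrtr// sumr_ge0// => i _; rewrite -expr2 sqr_ge0. Qed.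

Lemma is_derive_coord {R : realType} {V : normedModType R} {n : nat}
  (f : V -> 'rV[R]_n) (x v : V) (df : 'rV[R]_n) (i : 'I_n) :
  is_derive x v f df -> is_derive x v (fun y => f y 0 i) (df 0 i).
Proof.
move=> [dfx <-]; apply: DeriveDef; first by move/derivable_mxP : dfx; exact.
by rewrite derive_mx// mxE.
Qed.

Lemma is_derive_dotv {R : realType} {V : normedModType R} {n : nat}
  (f g : V -> 'rV[R]_n) (x v : V) (df dg : 'rV[R]_n) :
  is_derive x v f df -> is_derive x v g dg ->
  is_derive x v (fun y => dotv (f y) (g y)) (dotv (f x) dg + dotv (g x) df).
Proof.
move=> dfx dgx.
have -> : (fun y => dotv (f y) (g y)) =
    \sum_(i < n) ((fun y => f y 0 i) * (fun y => g y 0 i)).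
  by apply/funext => y; rewrite fct_sumE.
rewrite /dotv -big_split/=; apply: is_derive_sum => i.
by apply: is_deriveM; exact: is_derive_coord.
Qed.

(** Differentiability makes the directional derivative linear in the direction,
    so that the partial derivatives determine it. *)
Lemma derive_grad {R : realType} {n : nat} (f : 'rV[R]_n -> R)
  (x v : 'rV[R]_n) : differentiable f x -> 'D_v f x = dotv v (grad f x).
Proof.
move=> dfx; rewrite deriveE// {1}(row_sum_delta v) linear_sum.
by apply: eq_bigr => i _; rewrite linearZ/= mxE deriveE.
Qed.

Lemma is_derive_comp_grad {R : realType} {n : nat} (f : 'rV[R]_n -> R)
  (q : R -> 'rV[R]_n) (t : R) (dq : 'rV[R]_n) :
  differentiable f (q t) -> is_derive t 1 q dq ->
  is_derive t 1 (fun s => f (q s)) (dotv dq (grad f (q t))).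
Proof.
move=> dfq [/derivable1_diffP dqt <-].
have dfqt : differentiable (f \o q) t by exact: differentiable_comp.
apply: DeriveDef; first exact/derivable1_diffP.
by rewrite deriveE// diff_comp//= -derive_grad// !deriveE.
Qed.

(** Euler's identity: compare the two expressions of the derivative at [s = 1]
    of [s |-> U (s x) = s^alpha U x], by the chain rule along the ray through
    [x] and by the power rule. *)
Lemma euler_homogeneous {R : realType} {n : nat} (alpha : R)
  (U : 'rV[R]_n -> R) (x : 'rV[R]_n) :
  differentiable U x ->
  (forall lambda, 0 < lambda -> U (lambda *: x) = lambda `^ alpha * U x) ->
  dotv x (grad U x) = alpha * U x.
Proof.
move=> dUx Uhom.
have dline : is_derive (1 : R) (1 : R) (fun s : R => s *: x) x.
  have dx := is_diff_scalel 1 x.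
  apply: DeriveDef; first exact: diff_derivable.
  by rewrite deriveE// diff_val scale1r.
have dU : is_derive (1 : R) (1 : R) (fun s => U (s *: x)) (dotv x (grad U x)).
  by have := @is_derive_comp_grad _ _ U _ 1 x _ dline; rewrite scale1r; apply.
have dpow : is_derive (1 : R) (1 : R) (fun s => U (s *: x)) (alpha * U x).
  apply: (@near_eq_is_derive _ _ _ (U x \*: (@powR R)^~ alpha)).
    (* Homogeneity is only available for s > 0, which holds near 1. *)
    near=> s; rewrite Uhom; last by near: s; exact: lt_nbhsr.
    by rewrite [RHS]mulrC.
  have dpowR := is_derive1_powR alpha (@ltr01 R).
  by apply: is_derive_eq; rewrite powR1 mulr1 /GRing.scale/= mulrC.
by rewrite -[LHS](@derive_val _ _ _ _ _ _ _ dU) derive_val.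
Unshelve. all: end_near. Qed.

Lemma grad_lagrangian_velocity {R : realType} {n : nat} (m : R)
  (U : 'rV[R]_n -> R) (t : R) (x v : 'rV[R]_n) :
  grad (lagrangian m U t x) v = m *: v.
Proof.
apply/rowP => i; rewrite !mxE.
have dd := is_derive_dotv _ _ _ _ _ _ (is_derive_id v (delta_mx 0 i))
  (is_derive_id v (delta_mx 0 i)).
rewrite (_ : lagrangian m U t x =
  2^-1 * m \*: (fun v => dotv v v) - cst (U x)); last first.
  by apply/funext => w; rewrite /lagrangian enorm_sqr.
rewrite derive_val subr0 !dotv_delta /GRing.scale/=; lra.
Qed.

Lemma grad_lagrangian_position {R : realType} {n : nat} (m : R)
  (U : 'rV[R]_n -> R) (t : R) (x v : 'rV[R]_n) :
  differentiable U x ->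
  grad (fun y => lagrangian m U t y v) x = - grad U x.
Proof.
move=> dUx; apply/rowP => i; rewrite !mxE.
have dU : derivable U x (delta_mx 0 i) by exact: diff_derivable.
rewrite (_ : (fun y => _) = cst (2^-1 * m * enorm v ^+ 2) - U)//.
by rewrite (deriveB (derivable_cst _ _ _) dU) derive_cst sub0r.
Qed.

(** The momentum [grad (L t (q t)) v] is [m v] for every [t] and [v], so the
    first term of the Lagrange equation is the derivative of [m q'] as a
    function on the whole line, not only along [I]. *)
Lemma newton_equation {R : realType} {n : nat} (m : R) (U : 'rV[R]_n -> R)
  (I : set R) (q : R -> 'rV[R]_n) (t : R) :
  lagrange_equation (lagrangian m U) I q -> I t ->
  differentiable U (q t) -> derivable (derive1 q) t 1 ->
  m *: 'D_1 (derive1 q) t = - grad U (q t).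
Proof.
move=> + It dU ddq => /(_ t It); rewrite grad_lagrangian_position//.
rewrite (_ : (fun s => grad _ _) = m \*: derive1 q); last first.
  by apply/funext => s; rewrite grad_lagrangian_velocity.
by rewrite derive1E deriveZ// => /eqP; rewrite subr_eq0 => /eqP.
Qed.

(** The factor [k] is kept outside the integral, and the antiderivative is that
    of [k f] rather than of [f], so that [k = 0] is covered: this is the case
    [alpha = -2] of the theorem, where [H' = 0], so that [H] does not yield an
    antiderivative of [L]. *)
Lemma oriented_integral_scaled_FTC {R : realType} (I : set R) (k : R)
  (f F : R -> R) (a b : R) :
  is_interval I -> (forall t, I t -> {for t, continuous f}) ->
  (forall t, I t -> is_derive t 1 F (k * f t)) -> I a -> I b ->
  k * oriented_integral a b f = F b - F a.
Proof.
move=> Iitv cf dF.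
have FTC c d : I c -> I d -> c <= d ->
    k * \int[lebesgue_measure]_(s in `[c, d]) f s = F d - F c.
  move=> Ic Id; rewrite le_eqVlt => /predU1P[->|cd].
    by rewrite set_itv1 Rintegral_set1 mulr0 subrr.
  have I_cd s : s \in `[c, d] -> I s.
    by rewrite in_itv/=; exact: Iitv.
  have cfcd : {within `[c, d], continuous f}.
    apply: continuous_in_subspaceT => s; rewrite inE => scd.
    exact/cf/I_cd.
  have cF s : I s -> {for s, continuous F}.
    move=> /dF Fs; apply: differentiable_continuous.
    exact/derivable1_diffP.
  rewrite -RintegralZl//; last first.
    by apply: continuous_compact_integrable => //; exact: segment_compact.
  rewrite /Rintegral (@continuous_FTC2 _ _ F)//.
  - apply: continuous_in_subspaceT => s; rewrite inE => /I_cd/cf.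
    exact: cvgM (cvg_cst k).
  - split.
    + by move=> s /subset_itv_oo_cc/I_cd/dF.
    + exact/cvg_at_right_filter/cF.
    + exact/cvg_at_left_filter/cF.
  - move=> s /subset_itv_oo_cc/I_cd/dF Fs.
    by rewrite derive1E derive_val.
move=> Ia Ib; rewrite /oriented_integral; case: leP => [|/ltW] ab.
  exact: FTC.
by rewrite mulrN FTC// opprB.
Qed.

Theorem mainTheorem12 (R : realType) (n : nat) (m alpha : R)
  (D : set 'rV[R]_n) (U : 'rV[R]_n -> R)
  (I : set R) (q : R -> 'rV[R]_n) (t0 : R)
  (m_gt0 : 0 < m)
  (D_open : open D)
  (D_cone : forall (lambda : R) (x : 'rV[R]_n),
     0 < lambda -> D x -> D (lambda *: x))
  (U_smooth : smooth_on D U)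
  (U_homogeneous : forall (lambda : R) (x : 'rV[R]_n),
     0 < lambda -> D x -> U (lambda *: x) = lambda `^ alpha * U x)
  (I_open : open I)
  (I_interval : is_interval I)
  (q_smooth : smooth_on I q)
  (q_in_D : forall t, I t -> D (q t))
  (q_solution : lagrange_equation (lagrangian m U) I q)
  (t0_in_I : I t0) :
  exists c : R, forall t, I t ->
    m * dotv (q t) (derive1 q t)
    + (alpha / 2 - 1) * t * energy m U (q t) (derive1 q t)
    - (alpha / 2 + 1) *
      oriented_integral t0 t (fun s => lagrangian m U s (q s) (derive1 q s))
    = c.
Proof.
have dq t : I t -> is_derive t 1 q (derive1 q t).
  move=> It; rewrite derive1E; apply: derivableP.
  by apply: diff_derivable; have [+ _] := q_smooth 1; exact.
have ddq t : I t -> is_derive t 1 (derive1 q) ('D_1 (derive1 q) t).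
  move=> It; apply: derivableP; apply: diff_derivable.
  rewrite (_ : derive1 q = 'D_1 q); last by apply/funext => s; rewrite derive1E.
  by have [_ /(_ 1)[+ _]] := q_smooth 2; exact.
have dU t : I t -> differentiable U (q t).
  by move=> It; have [+ _] := U_smooth 1; apply; exact: q_in_D.
have newton t : I t -> m *: 'D_1 (derive1 q) t = - grad U (q t).
  move=> It; have [ddqt _] := ddq t It.
  exact: newton_equation q_solution It (dU t It) ddqt.
pose T t := dotv (derive1 q t) (derive1 q t).
have dT t : I t -> is_derive t 1 T (2 * dotv (derive1 q t) ('D_1 (derive1 q) t)).
  move=> It; have dTt := is_derive_dotv _ _ _ _ _ _ (ddq _ It) (ddq _ It).
  by apply: is_derive_eq dTt _; lra.
have dUq t (It : I t) := is_derive_comp_grad _ _ _ _ (dU t It) (dq t It).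
pose L t := lagrangian m U t (q t) (derive1 q t).
pose E t := energy m U (q t) (derive1 q t).
have dL t : I t -> {for t, continuous L}.
  move=> It; apply: differentiable_continuous; apply/derivable1_diffP.
  have ? := dT t It; have ? := dUq t It.
  rewrite (_ : L = 2^-1 * m \*: T - (fun s => U (q s))).
    exact: ex_derive.
  by apply/funext => s; rewrite /L /lagrangian enorm_sqr.
have dE t : I t -> is_derive t 1 E 0.
  move=> It; have dTt := dT t It; have dUqt := dUq t It.
  rewrite (_ : E = 2^-1 * m \*: T + (fun s => U (q s))); last first.
    by apply/funext => s; rewrite /E /energy enorm_sqr.
  (* Power balance: m q'.q'' = - q'.grad U (q). *)
  have := congr1 (dotv (derive1 q t)) (newton t It).
  rewrite -scaleN1r !dotvZr mulN1r => newton_velocity.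
  apply: is_derive_eq (is_deriveD (is_deriveZ (2^-1 * m) dTt) dUqt) _.
  by rewrite /GRing.scale/=; lra.
pose H t := m * dotv (q t) (derive1 q t) + (alpha / 2 - 1) * t * E t.
have dH t : I t -> is_derive t 1 H ((alpha / 2 + 1) * L t).
  move=> It; have dEt := dE t It.
  have dqq' := is_derive_dotv _ _ _ _ _ _ (dq t It) (ddq t It).
  have euler : dotv (q t) (grad U (q t)) = alpha * U (q t).
    apply: euler_homogeneous; first exact: dU.
    by move=> lambda lambda_gt0; apply: U_homogeneous => //; exact: q_in_D.
  (* Virial identity: m q.q'' = - alpha U(q). *)
  have := congr1 (dotv (q t)) (newton t It).
  rewrite -scaleN1r !dotvZr mulN1r euler => virial.
  have dtE := is_deriveM (is_deriveZ (alpha / 2 - 1) (is_derive_id t 1)) dEt.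
  apply: is_derive_eq (is_deriveD (is_deriveZ m dqq') dtE) _.
  rewrite /GRing.scale/= /E /L /energy /lagrangian enorm_sqr.
  by lra.
exists (H t0) => t It; rewrite -/(H t).
by rewrite (oriented_integral_scaled_FTC _ _ _ _ _ _ I_interval dL dH)// subKr.
Qed.
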